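(* For every $K\in\mathbb{N}$ there is $N(K)\in\mathbb{N}$ such that for every finite $K$-approximate subfield $X$ (of any field), either $|X|<N(K)$ or $4X+X\cdot 4X$ is a subfield. More generally, suppose that natural numbers $N(K,n)$ depending only on $K$ and $n$ are given. Then for every $K\in\mathbb{N}$ there is $N(K)\in\mathbb{N}$ such that for every finite $K$-approximate subring $X$ of a field such that, for every positive $n\in\mathbb{N}$, $\mathrm{Alg}_n(X)$ is covered by $N(K,n)$ additive translates of $X$, either $|X|<N(K)$ or $4X+X\cdot 4X$ is a subfield.
   Context: For subsets $Y,Z$ of a field, $Y+Z=\{y+z\}$, $Y\cdot Z=\{yz\}$ ($y\in Y,z\in Z$), and $nZ$ is the set of sums of $n$ elements of $Z$. A finite subset $X$ of a field $F$ is a $K$-approximate subfield of $F$ if it is additively symmetric ($0\in X$, $X=-X$), multiplicatively symmetric ($1\in X$ and $X\setminus\{0\}=(X\setminus\{0\})^{-1}$), and there is $E\subseteq F$ with $|E|\leq K$ such that $X\cdot X+X\subseteq (E\cdot X)\cap(E+X)$. A subset $X$ of a ring is a $K$-approximate subring if it is additively symmetric and $(X\cdot X)\cup(X+X)$ is covered by $K$ additive translates of $X$. $\mathrm{Alg}_n(X)$ denotes the set of quotients $a/b$ (with $b\neq 0$) where each of $a,b$ is a sum of at most $n$ terms, each of which is a product of at most $n$ elements of $X$. *)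

(* Defs.v *)
From mathcomp Require Import all_boot all_order all_algebra.
From mathcomp Require Import finmap.
From mathcomp Require Import mathcomp_extra boolp classical_sets.
Set Implicit Arguments.
Unset Strict Implicit.
Unset Printing Implicit Defensive.

Import GRing.Theory.
Local Open Scope classical_set_scope.
Local Open Scope ring_scope.

Definition sumset (R : pzRingType) (Y Z : set R) : set R :=
  [set y + z | y in Y & z in Z].

Definition prodset (R : pzRingType) (Y Z : set R) : set R :=
  [set y * z | y in Y & z in Z].

(* Exactly [n] summands, repetitions allowed: this is the iterated sumset, not
   the dilate of [Z] by [n]. *)
Definition nsumset (R : pzRingType) (n : nat) (Z : set R) : set R :=
  [set x | exists s : seq R,
     [/\ size s = n, {in s, forall z, Z z} & x = \sum_(z <- s) z]].

Definition covered_by_translates (R : pzRingType) (K : nat) (A X : set R) :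
    Prop :=
  exists E : {fset R}, (#|` E| <= K)%N /\ A `<=` sumset [set` E] X.

Definition additively_symmetric (R : pzRingType) (X : set R) : Prop :=
  X 0 /\ X = [set - x | x in X].

Definition multiplicatively_symmetric (F : fieldType) (X : set F) : Prop :=
  X 1 /\ X `\ 0 = [set x^-1 | x in X `\ 0].

Definition approximate_subfield (F : fieldType) (K : nat) (X : {fset F}) :
    Prop :=
  [/\ additively_symmetric [set` X],
      multiplicatively_symmetric [set` X] &
      exists E : {fset F}, (#|` E| <= K)%N /\
        sumset (prodset [set` X] [set` X]) [set` X]
          `<=` prodset [set` E] [set` X] `&` sumset [set` E] [set` X]].

Definition approximate_subring (R : pzRingType) (K : nat) (X : set R) : Prop :=
  additively_symmetric X /\
  covered_by_translates K (prodset X X `|` sumset X X) X.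

(* "At most [n]" includes zero: the empty sum is 0 and the empty product is 1. *)
Definition sums_of_products (R : pzRingType) (n : nat) (X : set R) : set R :=
  [set a | exists s : seq (seq R),
     [/\ (size s <= n)%N,
         {in s, forall t, (size t <= n)%N /\ {in t, forall x, X x}} &
         a = \sum_(t <- s) \prod_(x <- t) x]].

Definition Alg (F : fieldType) (n : nat) (X : set F) : set F :=
  [set q | exists a b : F,
     [/\ sums_of_products n X a, sums_of_products n X b, b != 0 & q = a / b]].

(* Since 0^-1 = 0 in a [fieldType], closure under 1, x - y and x / y is closure
   under the field operations. *)
Definition is_subfield (F : fieldType) (S : set F) : Prop :=
  GRing.divring_closed [pred x | x \in S].

(* Main.v *)
(** Put Q = (X + X) / (X + X).  If X is commensurable with both u X and v X, then
    u X + v X has O(|X|) elements, so for |X| large two of the |X|^2 expressions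
    u x + v y coincide and u / v lies in Q.  The elements u for which u X is
    covered by boundedly many translates of X are closed under bounded words in
    the ring operations, which makes Q a field; and |Q| = O(|X|).  Inside Q the
    dense set X is treated by a second moment count over the slopes x in Q: since
    two distinct points of X^2 project to the same point along at most one slope,
    some x in X has |X + x X| > |Q| / 2, whence Q = (X + x X) + (X + x X). *)
Require Import Defs.
From mathcomp Require Import all_boot all_order all_algebra.
From mathcomp Require Import finmap.
From mathcomp Require Import mathcomp_extra boolp classical_sets.
From mathcomp Require Import zify ring.
Set Implicit Arguments.
Unset Strict Implicit.
Unset Printing Implicit Defensive.

Import GRing.Theory.
Local Open Scope classical_set_scope.
Local Open Scope ring_scope.

(** * Cauchy-Schwarz and the counting of collisions *)

Lemma sqr_sum_leq (I : Type) (r : seq I) (c : I -> nat) :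
  ((\sum_(t <- r) c t) ^ 2 <= size r * \sum_(t <- r) c t ^ 2)%N.
Proof.
elim: r => [|i r IHr]; first by rewrite !big_nil.
rewrite !big_cons /=.
have cross : (2 * (c i * \sum_(t <- r) c t)
              <= size r * c i ^ 2 + \sum_(t <- r) c t ^ 2)%N.
  rewrite -sum1_size !big_distrl !big_distrr /= -big_split /=.
  by apply: leq_sum => t _; rewrite mul1n nat_Cauchy.
rewrite sqrnD; nia.
Qed.

(** The double sum equals the sum of the squared fibre sizes of [f], so this is Cauchy-Schwarz over
    the distinct values of [f] on [s]. *)
Lemma sqr_size_leq_collisions (I : Type) (T : eqType) (s : seq I) (f : I -> T) :
  (size s ^ 2 <= size (undup (map f s))
                 * \sum_(i <- s) \sum_(j <- s) (f i == f j))%N.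
Proof.
(* A sum is regrouped by the value of [f]. Letting [s'] vary while the index list [undup (map f s)]
   stays fixed is what makes the induction possible. *)
have fib (g : T -> nat) (s' : seq I) : {subset map f s' <= map f s} ->
    (\sum_(i <- s') g (f i)
     = \sum_(t <- undup (map f s)) \sum_(i <- s') (f i == t) * g t)%N.
  elim: s' => [|i s' IHs'] sub; first by rewrite big_nil big1 // => t; rewrite big_nil.
  rewrite big_cons IHs'; last by move=> t t_in; apply: sub; rewrite in_cons t_in orbT.
  under [RHS]eq_bigr do rewrite big_cons.
  rewrite big_split /=; congr (_ + _)%N.
  rewrite (bigD1_seq (f i)) ?undup_uniq ?mem_undup ?sub ?mem_head //= eqxx mul1n.
  by rewrite big1 ?addn0 // => t; rewrite eq_sym => /negPf ->.
have count1 t : (\sum_(i <- s) (f i == t) * 1 = \sum_(i <- s) (f i == t))%N.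
  by apply: eq_bigr => i _; rewrite muln1.
have -> : (\sum_(i <- s) \sum_(j <- s) (f i == f j)
           = \sum_(t <- undup (map f s)) (\sum_(i <- s) (f i == t)) ^ 2)%N.
  rewrite (fib (fun t => \sum_(j <- s) (t == f j))%N) //.
  apply: eq_bigr => t _; rewrite -big_distrl /= -mulnn; congr (_ * _)%N.
  by apply: eq_bigr => i _; rewrite eq_sym.
rewrite -sum1_size (fib (fun=> 1%N)) //.
under eq_bigr do rewrite count1.
exact: sqr_sum_leq.
Qed.

(** * Projections of pairs from a dense subset of a finite ring *)

Section DenseSubset.
Variables (F : fieldType) (X Q : seq F).
Hypotheses (uniqX : uniq X) (uniqQ : uniq Q) (subXQ : {subset X <= Q}).
Hypothesis QB : {in Q &, forall x y, x - y \in Q}.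
Hypothesis QM : {in Q &, forall x y, x * y \in Q}.

Let pairs := [seq (a, b) | a <- X, b <- X].
Let slope (x : F) (p : F * F) := p.1 + x * p.2.
Let lines x := undup (map (slope x) pairs).

Let QD : {in Q &, forall x y, x + y \in Q}.
Proof.
by move=> x y xQ yQ; rewrite (_ : x + y = x - (x - x - y)) ?QB ?QB ?QB //; ring.
Qed.

Lemma lines_sub x : x \in Q -> {subset lines x <= Q}.
Proof.
move=> xQ t; rewrite mem_undup => /mapP[_ /allpairsP[[a b] [/= aX bX ->]] ->].
by apply: QD; [|apply: QM => //]; apply: subXQ.
Qed.

(** If (a, b) and (c, d) collide at two slopes x and y, subtracting gives (y - x)(b - d) = 0, hence
    b = d and then a = c. *)
Lemma collision_slopes_leq1 (p p' : F * F) :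
  p != p' -> (\sum_(x <- Q) (slope x p == slope x p') <= 1)%N.
Proof.
move=> npp'.
have [/hasP[x xQ /eqP eqx]|/hasPn none] := boolP (has (fun x => slope x p == slope x p') Q);
  last by rewrite big1_seq // => x /= /none /negPf ->.
rewrite (bigD1_seq x) //= big1 ?addn0 ?leq_b1 // => y nyx.
case: eqP => // eqy; case/eqP: npp'; move: p p' eqx eqy => [a b] [c d].
rewrite /slope /= => eqx eqy.
have : (y - x) * (b - d) = 0.
  have -> : (y - x) * (b - d) = (a + y * b - (c + y * d)) - (a + x * b - (c + x * d)).
    by ring.
  by rewrite eqx eqy !subrr.
move/eqP; rewrite mulf_eq0 subr_eq0 (negPf nyx) /= subr_eq0 => /eqP eqbd.
by move: eqx; rewrite eqbd => /addIr ->.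
Qed.

(** For a fixed pair p, p itself collides with p at all |Q| slopes, and each of the at most |X|^2
    other pairs does so at one slope at most. *)
Lemma total_collisions_leq :
  (\sum_(x <- Q) \sum_(p <- pairs) \sum_(p' <- pairs) (slope x p == slope x p')
   <= size X ^ 2 * size Q + size X ^ 4)%N.
Proof.
have uniq_pairs : uniq pairs by rewrite allpairs_uniq //; case=> [? ?] [? ?].
have size_pairs : size pairs = (size X ^ 2)%N by rewrite size_allpairs mulnn.
rewrite exchange_big /=; under eq_bigr do rewrite exchange_big /=.
have -> : (size X ^ 2 * size Q + size X ^ 4
           = \sum_(p <- pairs) (size Q + size X ^ 2))%N.
  by rewrite big_const_seq iter_addn_0 count_predT size_pairs; ring.
rewrite big_seq_cond [leqRHS]big_seq_cond; apply: leq_sum => p; rewrite andbT => p_in.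
rewrite (bigD1_seq p) //=; apply: leq_add.
  by under eq_bigr do rewrite eqxx; rewrite sum1_size.
rewrite -size_pairs -sum1_size [leqRHS](bigD1_seq p) //=.
apply: leq_trans (leq_addl _ _); apply: leq_sum => p' npp'.
by rewrite collision_slopes_leq1 // eq_sym.
Qed.

(** Otherwise Cauchy-Schwarz forces at least 2|X|^4 / |Q| collisions at each slope in X, and |X|^4 /
    |Q| at every other slope of Q. Summing over Q and comparing with [total_collisions_leq], the
    terms |X|^4 |Q| cancel and |X|^5 <= |X|^2 |Q|^2 remains, against the hypothesis. *)
Lemma exists_slope_many_lines : (size Q ^ 2 < size X ^ 3)%N ->
  exists2 x, x \in X & (size Q < 2 * size (lines x))%N.
Proof.
move=> big.
have [/hasP[x xX xP]|/hasPn none] := boolP (has (fun x => size Q < 2 * size (lines x))%N X);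
  first by exists x.
pose coll x := (\sum_(p <- pairs) \sum_(p' <- pairs) (slope x p == slope x p'))%N.
have size_pairs : size pairs = (size X ^ 2)%N by rewrite size_allpairs mulnn.
have energy x : (size X ^ 4 <= size (lines x) * coll x)%N.
  have := sqr_size_leq_collisions pairs (slope x).
  by rewrite size_pairs -expnM.
(* The factor 1 + (x \in X) records the doubled bound at slopes in X. *)
have low x : x \in Q -> (size X ^ 4 * (1 + (x \in X)) <= size Q * coll x)%N.
  move=> xQ; case: (boolP (x \in X)) => [/none|_] /=.
    rewrite -leqNgt => le_lines; rewrite mulnC.
    apply: leq_trans (leq_mul le_lines (leqnn (coll x))).
    by rewrite -mulnA leq_mul2l energy orbT.
  rewrite muln1; apply: leq_trans (energy x) _.
  by rewrite leq_mul2r (uniq_leq_size (undup_uniq _) (lines_sub xQ)) orbT.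
have sumX : (\sum_(x <- Q) (x \in X) = size X)%N.
  rewrite -sum1_size [RHS](perm_big [seq x <- Q | x \in X]) /=.
    by rewrite big_filter [RHS]big_mkcond /=; apply: eq_bigr => x _; case: ifP.
  apply: uniq_perm; rewrite ?filter_uniq // => x; rewrite mem_filter.
  by case: (boolP (x \in X)) => // /subXQ ->.
have : (size X ^ 4 * (size Q + size X) <= size Q * \sum_(x <- Q) coll x)%N.
  have -> : (size Q + size X = \sum_(x <- Q) (1 + (x \in X)))%N.
    by rewrite big_split /= sum1_size sumX.
  rewrite !big_distrr /=.
  by rewrite big_seq [leqRHS]big_seq; apply: leq_sum => x /low.
move: total_collisions_leq; rewrite -/coll.
move: (\sum_(x <- Q) coll x)%N (size X) (size Q) big => S m q big le1 le2.
have m2q2 : (m ^ 2 * m ^ 3 <= m ^ 2 * q ^ 2)%N by nia.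
have m_gt0 : (0 < m)%N by case: m big {le1 le2 m2q2}.
by move: m2q2; rewrite leq_pmul2l ?expn_gt0 ?m_gt0 // leqNgt big.
Qed.

Lemma dense_subset_cover z : (size Q ^ 2 < size X ^ 3)%N -> z \in Q ->
  exists2 x, x \in X & exists a b c d,
    [/\ a \in X, b \in X, c \in X, d \in X & z = (a + b) + x * (c + d)].
Proof.
move=> /exists_slope_many_lines[x xX many] zQ; exists x => //.
have subL := lines_sub (subXQ xX).
(* Pigeonhole: L = [lines x] and z - L both lie in Q and each fills more than half of it, so some t
   has both t and z - t in L. *)
have [/hasP[_ /mapP[t tL ->] ztL]|/hasPn none] :=
    boolP (has (mem (lines x)) [seq z - t | t <- lines x]).
  have inL s : s \in lines x -> exists a b, [/\ a \in X, b \in X & s = a + x * b].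
    by rewrite mem_undup => /mapP[_ /allpairsP[[a b] [/= aX bX ->]] ->]; exists a, b.
  have [[a [c [aX cX eqt]]] [b [d [bX dX eqzt]]]] := (inL _ tL, inL _ ztL).
  exists a, b, c, d; split=> //.
  by rewrite -[z](subrK t) eqzt eqt; ring.
have : (size (lines x ++ [seq (z - t)%R | t <- lines x]) <= size Q)%N.
  apply: uniq_leq_size.
    rewrite cat_uniq undup_uniq map_inj_uniq ?undup_uniq ?andbT //=.
      by apply/hasPn.
    by move=> s t /addrI /oppr_inj.
  move=> t; rewrite mem_cat => /orP[/subL //|/mapP[s /subL sQ ->]].
  exact: QB.
by rewrite size_cat size_map addnn -mul2n leqNgt many.
Qed.

End DenseSubset.

(** * Coverings by translates, and dilates *)

Lemma covered_seqP (R : pzRingType) (K : nat) (A X : set R) :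
  covered_by_translates K A X <->
  exists s : seq R, (size s <= K)%N /\
    forall a, A a -> exists2 e, e \in s & X (a - e).
Proof.
split=> [[E [leEK sub]]|[s [les sub]]].
  exists (enum_fset E); split=> // a /sub[e eE [x xX <-]].
  exists e; first exact: eE.
  by rewrite [e + x]addrC addrK.
exists [fset e in s]%fset; split.
  by rewrite card_fseq (leq_trans (size_undup s)).
move=> a /sub[e es aeX]; exists e; first by rewrite /= !inE.
by exists (a - e) => //; rewrite addrC subrK.
Qed.

Lemma covered_leq (R : pzRingType) (K L : nat) (A B X : set R) :
  (K <= L)%N -> A `<=` B -> covered_by_translates K B X ->
  covered_by_translates L A X.
Proof.
move=> leKL subAB [E [leE sub]]; exists E.
by split; [apply: leq_trans leKL|move=> a /subAB/sub].
Qed.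

Lemma card_covered (F : fieldType) (K : nat) (s : seq F) (X : {fset F}) :
  uniq s -> covered_by_translates K [set` s] [set` X] ->
  (size s <= K * #|` X|)%N.
Proof.
move=> uniq_s /covered_seqP[E [leEK sub]].
apply: (@leq_trans (size [seq e + x | e <- E, x <- X])).
  apply: uniq_leq_size => // a /sub[e eE aeX]; apply/allpairsP.
  by exists (e, a - e); split=> //=; rewrite addrC subrK.
by rewrite size_allpairs leq_mul2r leEK orbT.
Qed.

Lemma covered_sumset (R : pzRingType) (K k l : nat) (A B X : set R) :
  covered_by_translates K (sumset X X) X ->
  covered_by_translates k A X -> covered_by_translates l B X ->
  covered_by_translates (k * l * K) (sumset A B) X.
Proof.
move=> /covered_seqP[E [leE subE]] /covered_seqP[s [les subs]] /covered_seqP[t [let' subt]].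
apply/covered_seqP.
exists [seq x + e | x <- [seq a + b | a <- s, b <- t], e <- E]; split.
  by rewrite !size_allpairs !leq_mul.
move=> _ [a aA [b bB <-]].
have [d ds adX] := subs a aA; have [e et beX] := subt b bB.
have [|f fE xfX] := subE (a - d + (b - e)); first by exists (a - d) => //; exists (b - e).
exists (d + e + f).
  apply/allpairsP; exists (d + e, f); split=> //.
  by apply/allpairsP; exists (d, e).
by rewrite opprD addrA opprD addrACA.
Qed.

(** The number of translates of X that cover a X acts as a cost of a; the lemmas below bound the
    cost of a ring expression by the costs of its entries. *)
Definition dilate (R : pzRingType) (a : R) (X : set R) : set R :=
  [set a * x | x in X].

Lemma approximate_subringN (R : pzRingType) (K : nat) (X : set R) (x : R) :
  approximate_subring K X -> X x -> X (- x).
Proof. by move=> [[_ defX] _] xX; rewrite defX; exists x. Qed.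

Section Dilates.
Variables (F : fieldType) (K : nat) (X : set F).
Hypothesis subringX : approximate_subring K X.

Lemma covered_sumset_self : covered_by_translates K (sumset X X) X.
Proof. by case: subringX => _; apply: covered_leq => // x; right. Qed.

Lemma covered_dilate_mem a : X a -> covered_by_translates K (dilate a X) X.
Proof.
move=> aX; case: subringX => _; apply: covered_leq => // _ [x xX <-]; left.
by exists a => //; exists x.
Qed.

Lemma covered_dilateN k a : covered_by_translates k (dilate a X) X ->
  covered_by_translates k (dilate (- a) X) X.
Proof.
apply: covered_leq => // _ [x xX <-]; exists (- x); last by rewrite mulNr mulrN.
exact: approximate_subringN subringX _.
Qed.

Lemma covered_dilateD k l a b :
  covered_by_translates k (dilate a X) X ->
  covered_by_translates l (dilate b X) X ->
  covered_by_translates (k * l * K) (dilate (a + b) X) X.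
Proof.
move=> ka lb; apply: covered_leq (covered_sumset covered_sumset_self ka lb) => //.
move=> _ [x xX <-]; rewrite mulrDl; exists (a * x); first by exists x.
by exists (b * x) => //; exists x.
Qed.

(** From b X in t + X and a X in s + X it follows that a b X lies in a t + a X, hence in s + a t +
    X: products cost no extra factor K. *)
Lemma covered_dilateM k l a b :
  covered_by_translates k (dilate a X) X ->
  covered_by_translates l (dilate b X) X ->
  covered_by_translates (k * l) (dilate (a * b) X) X.
Proof.
move=> /covered_seqP[s [les subs]] /covered_seqP[t [let' subt]].
apply/covered_seqP; exists [seq d + a * e | d <- s, e <- t].
rewrite size_allpairs leq_mul //; split=> // _ [x xX <-].
have [|e et bxX] := subt (b * x); first by exists x.
have [|d ds aX] := subs (a * (b * x - e)); first by exists (b * x - e).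
exists (d + a * e); first by apply/allpairsP; exists (d, e).
by rewrite (_ : _ - _ = a * (b * x - e) - d) //; ring.
Qed.

End Dilates.

(** * The field of ratios *)

Definition ratios (F : fieldType) (X : seq F) : seq F :=
  let D := [seq a + b | a <- X, b <- X] in undup [seq a / b | a <- D, b <- D].

Lemma exists_nonzero (V : zmodType) (X : {fset V}) :
  (1 < #|` X|)%N -> exists2 x, x \in X & x != 0.
Proof.
move=> X_gt1; have : ~~ (X `<=` [fset 0])%fset.
  by apply/negP => /fsubset_leq_card; rewrite cardfs1 leqNgt X_gt1.
by move=> /fsubsetPn[x xX]; rewrite inE; exists x.
Qed.

Section Ratios.
Variables (F : fieldType) (K M : nat) (X : {fset F}).
Hypothesis subringX : approximate_subring K [set` X].
(* With a, b, c, d in X + X each costing a factor K^3, the dilates by ad - bc and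
   bd needed for a / b - c / d cost K^13 and K^6, and adding them one more K. *)
Hypothesis leKM : (K ^ 20 <= M)%N.
Hypothesis bigX : (M < #|` X|)%N.

Let Q := ratios X.
Let X0 : 0 \in X. Proof. by case: subringX => -[]. Qed.
Let XN x : x \in X -> - x \in X. Proof. exact: approximate_subringN subringX. Qed.
Let K_gt0 : (0 < K)%N.
Proof.
case: subringX => _ [E [leE sub]]; rewrite lt0n; apply/eqP => K0.
have [|e] := sub 0; first by left; exists 0 => //; exists 0 => //; rewrite mulr0.
by move: leE; rewrite K0 leqn0 => /eqP/cardfs0_eq ->.
Qed.

Lemma ratiosP q : reflect (exists a b c d : F,
  [/\ a \in X, b \in X, c \in X, d \in X & q = (a + b) / (c + d)]) (q \in Q).
Proof.
rewrite mem_undup; apply: (iffP allpairsP) => [[[u v] [/= /allpairsP[[a b] [/= aX bX ->]]]]|].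
  by move=> /allpairsP[[c d] [/= cX dX ->]] ->; exists a, b, c, d.
move=> [a [b [c [d [aX bX cX dX ->]]]]]; exists (a + b, c + d).
by split=> //=; apply/allpairsP; [exists (a, b)|exists (c, d)].
Qed.

Let X_gt1 : (1 < #|` X|)%N.
Proof.
by apply: leq_ltn_trans bigX; apply: leq_trans leKM; rewrite expn_gt0 K_gt0.
Qed.

(** If u / v is not in Q, then (x, y) -> u x + v y is injective on X^2, giving |X|^2 values; but u X
    + v X is covered by M < |X| translates of X, so it has at most M |X| elements. A collision gives
    u / v = (y' - y) / (x - x'). *)
Lemma ratio_mem k l (u v : F) : v != 0 ->
  covered_by_translates k (dilate u [set` X]) [set` X] ->
  covered_by_translates l (dilate v [set` X]) [set` X] ->
  (k * l * K <= M)%N -> u / v \in Q.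
Proof.
move=> v0 ku lv le_kl.
have cov := covered_sumset (covered_sumset_self subringX) ku lv.
pose s := [seq u * x + v * y | x <- X, y <- X].
have sub : [set` undup s] `<=` sumset (dilate u [set` X]) (dilate v [set` X]).
  move=> t /=; rewrite mem_undup => /allpairsP[[x y] [/= xX yX ->]].
  by exists (u * x); [exists x|exists (v * y) => //; exists y].
have := card_covered (undup_uniq s) (covered_leq le_kl sub cov) => le_s.
have : ~~ uniq s.
  apply/negP => /undup_id eqs; move: le_s; rewrite eqs size_allpairs.
  by rewrite leq_pmul2r ?(leq_ltn_trans _ bigX) // leqNgt bigX.
apply: contraNT => notQ; apply: allpairs_uniq; try exact: fset_uniq.
move=> -[? ?] [? ?] /allpairsP[[x y] [/= xX yX [-> ->]]].
move=> /allpairsP[[x' y'] [/= x'X y'X [-> ->]]] /= eqt.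
have eqt' : u * (x - x') = v * (y' - y).
  apply/eqP; rewrite -subr_eq0 (_ : _ - _ = u * x + v * y - (u * x' + v * y')); last by ring.
  by rewrite eqt subrr.
(* Equal first coordinates force y = y' because v is nonzero, so a genuine collision has a nonzero
   denominator x - x'. *)
have [eqx|neqx] := eqVneq x x'.
  move/eqP: eqt'; rewrite eqx subrr mulr0 eq_sym mulf_eq0 (negPf v0) subr_eq0.
  by move=> /eqP ->.
case/negP: notQ; apply/ratiosP; exists y', (- y), x, (- x').
split; rewrite ?XN //; apply/eqP.
by rewrite eqr_div // ?subr_eq0 // eqt' mulrC.
Qed.

Lemma ratio_repr q : q \in Q -> exists u v : F, [/\ v != 0,
  covered_by_translates (K ^ 3) (dilate u [set` X]) [set` X],
  covered_by_translates (K ^ 3) (dilate v [set` X]) [set` X] & q = u / v].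
Proof.
have cov a b : a \in X -> b \in X ->
    covered_by_translates (K ^ 3) (dilate (a + b) [set` X]) [set` X].
  move=> aX bX; rewrite (_ : K ^ 3 = K * K * K)%N; last by ring.
  by apply: covered_dilateD => //; apply: covered_dilate_mem.
move=> /ratiosP[a [b [c [d [aX bX cX dX ->]]]]].
have [cd0|] := eqVneq (c + d) 0; last by exists (a + b), (c + d); split=> //; apply: cov.
have [x xX x0] := exists_nonzero X_gt1.
exists (0 + 0), (x + 0); split; try exact: cov; first by rewrite addr0.
by rewrite cd0 invr0 mulr0 addr0 mul0r.
Qed.

Let leK (n : nat) : (n <= 20)%N -> (K ^ n <= M)%N.
Proof. by move=> le_n; apply: leq_trans leKM; rewrite leq_pexp2l. Qed.

(** Numerators and denominators of differences and quotients of ratios are short expressions in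
    elements of bounded cost, so [ratio_mem] brings the results back into Q. *)
Lemma ratios_divring : GRing.divring_closed [pred q | q \in Q].
Proof.
have [x xX x0] := exists_nonzero X_gt1.
have cX y : y \in X -> covered_by_translates K (dilate y [set` X]) [set` X].
  by move=> yX; apply: covered_dilate_mem.
have le3 : (K * K * K <= M)%N by rewrite mulnn -expnSr leK.
split.
- by rewrite inE -(divff x0); apply: ratio_mem x0 (cX _ xX) (cX _ xX) le3.
- move=> p q; rewrite !inE => /ratio_repr[a [b [b0 ca cb ->]]].
  move=> /ratio_repr[c [d [d0 cc cd ->]]].
  rewrite -mulNr addf_div // mulNr.
  have cN := covered_dilateN subringX (covered_dilateM cc cb).
  have cu := covered_dilateD subringX (covered_dilateM ca cd) cN.
  apply: ratio_mem (mulf_neq0 b0 d0) cu (covered_dilateM cb cd) _.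
  by apply: leq_trans (leK (leqnn 20)); apply: eq_leq; ring.
- move=> p q; rewrite !inE => /ratio_repr[a [b [b0 ca cb ->]]].
  move=> /ratio_repr[c [d [d0 cc cd ->]]].
  have [->|c0] := eqVneq c 0.
    by rewrite mul0r invr0 mulr0 -(mul0r x^-1); apply: ratio_mem x0 (cX _ X0) (cX _ xX) le3.
  rewrite invf_div mulf_div.
  apply: ratio_mem (mulf_neq0 b0 c0) (covered_dilateM ca cd) (covered_dilateM cb cc) _.
  by rewrite -!expnD -expnSr leK.
Qed.

(** Since 1 need not lie in X, y is written as (y x) / x, at total cost K^4. *)
Lemma sub_ratios : {subset X <= Q}.
Proof.
move=> y yX; have [x xX x0] := exists_nonzero X_gt1; rewrite -(mulfK x0 y).
have cx := covered_dilate_mem subringX xX.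
apply: ratio_mem x0 (covered_dilateM (covered_dilate_mem subringX yX) cx) cx _.
by rewrite mulnn -!expnSr leK.
Qed.

End Ratios.

(** * From few ratios to the subfield *)

(** The set equals Q: it lies in Q because Q is a field containing X, and it exhausts Q by
    [dense_subset_cover]. The bound K^20 makes Q a field; C^2 < |X| makes X dense enough, as |Q|^2
    <= C^2 |X|^2 < |X|^3. *)
Lemma approximate_subring_is_subfield (F : fieldType) (K C : nat) (X : {fset F}) :
  approximate_subring K [set` X] ->
  (size (ratios X) <= C * #|` X|)%N -> (K ^ 20 + C ^ 2 < #|` X|)%N ->
  is_subfield (sumset (nsumset 4 [set` X]) (prodset [set` X] (nsumset 4 [set` X]))).
Proof.
move=> subringX leQ bigX.
have leK := leq_addr (C ^ 2) (K ^ 20).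
have [Q1 QB QV] := ratios_divring subringX leK bigX.
have subXQ := sub_ratios subringX leK bigX.
set S := sumset _ _; suff eqS : (fun z => z \in S) = (fun z => z \in ratios X).
  by rewrite /is_subfield eqS.
have QM : {in ratios X &, forall x y, x * y \in ratios X}.
  by move=> x y xQ yQ; rewrite -[y]invrK; apply: (QV) => //; rewrite -div1r; apply: (QV).
have Q0 : 0 \in ratios X by rewrite -(subrr 1); apply: (QB).
have QD : {in ratios X &, forall x y, x + y \in ratios X}.
  by move=> x y xQ yQ; rewrite -[y]opprK; apply: (QB) => //; rewrite -sub0r; apply: (QB).
have X0 : 0 \in X by case: subringX => -[].
apply/funext => z; apply/idP/idP => [/set_mem|zQ]; last apply/mem_set.
  have Qsum y : nsumset 4 [set` X] y -> y \in ratios X.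
    case=> s [_ sX ->]; rewrite big_seq.
    by apply: (big_ind (fun y => y \in ratios X)) => // x /sX/subXQ.
  move=> [y /Qsum yQ [_ [x /subXQ xQ [w /Qsum wQ <-]] <-]].
  by apply: QD => //; apply: QM.
(* Two zeros pad the sum to exactly four summands. *)
have sum2 a b : a \in X -> b \in X -> nsumset 4 [set` X] (a + b).
  move=> aX bX; exists [:: a; b; 0; 0]; split=> //; last first.
    by rewrite !big_cons big_nil !addr0.
  by move=> x; rewrite !inE => /or4P[]/eqP->.
have sizes : (size (ratios X) ^ 2 < #|` X| ^ 3)%N.
  have X_gt : (C ^ 2 < #|` X|)%N by apply: leq_ltn_trans bigX; apply: leq_addl.
  apply: (@leq_ltn_trans ((C * #|` X|) ^ 2)); first by rewrite leq_exp2r.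
  rewrite expnMn [ltnRHS]expnS ltn_pmul2r //.
  by rewrite expn_gt0 (leq_ltn_trans _ X_gt).
have [x xX [a [b [c [d [aX bX cX dX ->]]]]]] :=
  dense_subset_cover (fset_uniq X) (undup_uniq _) subXQ QB QM sizes zQ.
exists (a + b); first exact: sum2.
by exists (x * (c + d)) => //; exists x => //; exists (c + d) => //; apply: sum2.
Qed.

(** * Bounding the number of ratios under each hypothesis *)

(** As 0 and 1 lie in X, both X X and X + X are contained in X X + X, so the same E serves. *)
Lemma approximate_subfield_subring (F : fieldType) (K : nat) (X : {fset F}) :
  approximate_subfield K X -> approximate_subring K [set` X].
Proof.
move=> [symX [X1 _] [E [leE sub]]]; split=> //; exists E; split=> //.
have X0 := symX.1.
move=> _ [[x xX [y yX <-]]|[x xX [y yX <-]]].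
  have [|_] := sub (x * y) => //.
  by exists (x * y); [exists x => //; exists y|exists 0; rewrite ?addr0].
have [|_] := sub (x + y) => //.
by exists x; [exists x => //; exists 1; rewrite ?mulr1|exists y].
Qed.

(* X + X lies in E X and X \ 0 is closed under inversion, so every ratio lies
   in E X (E X)^-1, hence in E E^-1 X X, hence in E E^-1 E X. *)
Lemma size_ratios_approximate_subfield (F : fieldType) (K : nat) (X : {fset F}) :
  approximate_subfield K X -> (size (ratios X) <= K ^ 3 * #|` X|)%N.
Proof.
move=> [symX [X1 symV] [E [leE sub]]]; have X0 : 0 \in X := symX.1.
have XV x : x \in X -> x^-1 \in X.
  have [->|x0 xX] := eqVneq x 0; first by rewrite invr0.
  suff [] : ([set` X] `\ 0) x^-1 by [].
  by rewrite symV; exists x => //; split=> //; apply/eqP.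
have sum2 a b : a \in X -> b \in X -> exists e x, [/\ e \in E, x \in X & a + b = e * x].
  move=> aX bX; have [|[e eE [x xX <-]] _] := sub (a + b); last by exists e, x.
  by exists a; [exists a => //; exists 1; rewrite ?mulr1|exists b].
have mul2 a b : a \in X -> b \in X -> exists e x, [/\ e \in E, x \in X & a * b = e * x].
  move=> aX bX; have [|[e eE [x xX <-]] _] := sub (a * b); last by exists e, x.
  by exists (a * b); [exists a => //; exists b|exists 0; rewrite ?addr0].
pose EE := [seq e / f | e <- E, f <- E].
apply: (@leq_trans (size [seq d * x | d <- [seq d * g | d <- EE, g <- E], x <- X])).
  apply: uniq_leq_size (undup_uniq _) _ => q /ratiosP[a [b [c [d [aX bX cX dX ->]]]]].
  have [e [x [eE xX ->]]] := sum2 a b aX bX; have [f [y [fE yX ->]]] := sum2 c d cX dX.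
  have [g [z [gE zX eqz]]] := mul2 x y^-1 xX (XV y yX).
  apply/allpairsP; exists (e / f * g, z); split=> //=.
    by apply/allpairsP; exists (e / f, g); split=> //; apply/allpairsP; exists (e, f).
  by rewrite -mulf_div eqz mulrA.
rewrite !size_allpairs leq_mul2r mulnn -expnSr.
by apply/orP; right; rewrite leq_exp2r.
Qed.

Lemma size_ratios_Alg (F : fieldType) (K : nat) (X : {fset F}) :
  additively_symmetric [set` X] -> (1 < #|` X|)%N ->
  covered_by_translates K (Alg 2 [set` X]) [set` X] ->
  (size (ratios X) <= K * #|` X|)%N.
Proof.
move=> [X0 _] X_gt1 cov; apply: card_covered (undup_uniq _) _.
apply: covered_leq cov => // q /ratiosP[a [b [c [d [aX bX cX dX ->]]]]].
have sum2 u v : u \in X -> v \in X -> sums_of_products 2 [set` X] (u + v).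
  move=> uX vX; exists [:: [:: u]; [:: v]]; split=> //; last first.
    by rewrite !big_cons !big_nil !mulr1 addr0.
  by move=> t; rewrite !inE => /orP[]/eqP->; split=> // x; rewrite inE => /eqP->.
(* [Alg] demands a nonzero denominator, so a ratio with c + d = 0 is rewritten as 0 / x. *)
have [cd0|cd0] := eqVneq (c + d) 0; last by exists (a + b), (c + d); split=> //; apply: sum2.
have [x xX x0] := exists_nonzero X_gt1.
exists (0 + 0), (x + 0); split; try exact: sum2; first by rewrite addr0.
by rewrite cd0 invr0 mulr0 addr0 mul0r.
Qed.

Theorem corollary1p14 :
  (forall K : nat, exists N : nat,
     forall (F : fieldType) (X : {fset F}),
       approximate_subfield K X ->
       (#|` X| < N)%N \/
       is_subfield (sumset (nsumset 4 [set` X])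
                           (prodset [set` X] (nsumset 4 [set` X]))))
  /\
  (forall (NA : nat -> nat -> nat) (K : nat), exists N : nat,
     forall (F : fieldType) (X : {fset F}),
       approximate_subring K [set` X] ->
       (forall n : nat, (0 < n)%N ->
          covered_by_translates (NA K n) (Alg n [set` X]) [set` X]) ->
       (#|` X| < N)%N \/
       is_subfield (sumset (nsumset 4 [set` X])
                           (prodset [set` X] (nsumset 4 [set` X])))).
Proof.
split=> [K|NA K].
  exists (K ^ 20 + (K ^ 3) ^ 2).+1 => F X fieldX.
  case: ltnP => [|bigX]; [by left | right].
  exact: approximate_subring_is_subfield (approximate_subfield_subring fieldX)
    (size_ratios_approximate_subfield fieldX) bigX.
(* Ratios already lie in [Alg 2], so C = [NA K 2]; the summand 1 guarantees a nonzero element of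
   X. *)
exists (K ^ 20 + (NA K 2) ^ 2 + 1).+1 => F X subringX cov.
case: ltnP => [|bigX]; [by left | right].
have X_gt1 : (1 < #|` X|)%N by apply: leq_ltn_trans bigX; rewrite leq_addl.
have leQ := size_ratios_Alg subringX.1 X_gt1 (cov 2 isT).
apply: approximate_subring_is_subfield subringX leQ _.
by apply: leq_ltn_trans bigX; rewrite leq_addr.
Qed.
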